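(* For all $\mu,\nu\in\mathcal{S}\mathrm{Curr}(F_N)$, the set function $U\mapsto(\mu\times\nu)(I^{-1}(U))$ on Borel subsets $U\subset\mathcal{C}_N$ is well defined and is a subset current; moreover for every $T\in\mathrm{Sub}(X,1)$ it satisfies $(\mu\times\nu)(I^{-1}(\mathrm{SCyl}(T)))\leq V(\mu)V(\nu)$, where $V(\mu)=\sum_{T'\in\mathcal{R}_1}\mu(\mathrm{SCyl}(T'))$. The resulting map $\widehat I\colon\mathcal{S}\mathrm{Curr}(F_N)^2\to\mathcal{S}\mathrm{Curr}(F_N)$ is $\mathbb{R}_{\geq0}$-bilinear.
   Context: $N\geq2$, $F_N$ free with free basis $A$, $X$ its Cayley graph (tree with vertex set $F_N$, edge lengths 1, path metric $d_X$), $\partial X$ its boundary. $\mathcal{C}_N$: closed subsets of $\partial X$ with at least two points, Vietoris (Hausdorff) topology; a subset current is an $F_N$-invariant Borel measure on $\mathcal{C}_N$ finite on compact sets. $I(S_1,S_2)=S_1\cap S_2\in\{\text{closed subsets of }\partial X\}$. For an oriented edge $e$ of $X$, $\mathrm{Cyl}(e)\subset\partial X$ is the set of ends of geodesic rays starting with $e$. $\mathrm{Sub}(X)$ is the set of finite subtrees of $X$ with at least two vertices; for $T\in\mathrm{Sub}(X)$ with terminal edges $e_1,\dots,e_m$ (oriented edges whose terminal vertex has degree one in $T$), $\mathrm{SCyl}(T)=\{S\in\mathcal{C}_N: S\subset\bigcup_i\mathrm{Cyl}(e_i),\ S\cap\mathrm{Cyl}(e_i)\neq\emptyset\ \forall i\}$.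 $\mathrm{Sub}(X,1)$ is the set of $T\in\mathrm{Sub}(X)$ containing $1$. $\mathcal{R}_1$ is the set of $T\in\mathrm{Sub}(X)$ containing $1$ such that $1$ has degree $\ge2$ in $T$ and every degree-one vertex $u$ of $T$ satisfies $d_X(1,u)=1$. *)

(* Defs.v *)
From HB Require Import structures.
From mathcomp Require Import all_boot all_order all_algebra.
From mathcomp Require Import finmap.
From mathcomp Require Import all_classical all_reals all_analysis.
Set Implicit Arguments. Unset Strict Implicit. Unset Printing Implicit Defensive.
Import Order.TTheory GRing.Theory Num.Theory.
Local Open Scope classical_set_scope.

Section FreeGroup.
Variable n : nat. (* N = n.+2 *)

Definition letter := ('I_n.+2 * bool)%type.
Definition linv (a : letter) : letter := (a.1, ~~ a.2).
Definition reduced (s : seq letter) := sorted (fun a b => b != linv a) s.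
Definition push (a : letter) (s : seq letter) :=
  if s is b :: s' then (if b == linv a then s' else a :: s) else [:: a].
Definition red (s : seq letter) := foldr push [::] s.
Definition winv (u : seq letter) := rev (map linv u).
Definition dX (u v : seq letter) : nat := size (red (winv u ++ v)).
Definition adjX (u v : seq letter) : bool := dX u v == 1%N.

Definition bdry := {xi : nat -> letter | forall k, xi k.+1 != linv (xi k)}.
HB.instance Definition _ := gen_eqMixin bdry.
HB.instance Definition _ := gen_choiceMixin bdry.
Definition a0 : letter := (ord0, true).
Lemma const_reduced : forall k, (fun _ : nat => a0) k.+1 != linv ((fun _ => a0) k).
Proof. by []. Qed.
Definition bdry_pt : bdry := exist _ (fun _ => a0) const_reduced.
HB.instance Definition _ := isPointed.Build bdry bdry_pt.

Definition pref (xi : bdry) (k : nat) : seq letter := mkseq (proj1_sig xi) k.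

HB.instance Definition _ := @isSubBaseTopological.Build bdry
  (nat * bdry)%type setT
  (fun p => [set eta : bdry | pref eta p.1 = pref p.2 p.1]).

Definition CN := {S : set bdry |
  closed S /\ exists x y, S x /\ S y /\ x <> y}.
HB.instance Definition _ := gen_eqMixin CN.
HB.instance Definition _ := gen_choiceMixin CN.
Lemma CN_whole_subproof : closed (@setT bdry) /\ exists x y : bdry, setT x /\ setT y /\ x <> y.
Proof.
split; first exact: closedT.
have h : forall k, (fun _ : nat => linv a0) k.+1 != linv ((fun _ => linv a0) k).
  by [].
exists bdry_pt, (exist _ _ h); split=> //; split=> //.
by move=> /(congr1 (fun x => proj1_sig x 0%N)).
Qed.
Definition CN_whole : CN := exist _ setT CN_whole_subproof.
HB.instance Definition _ := isPointed.Build CN CN_whole.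
HB.instance Definition _ := @isSubBaseTopological.Build CN
  (set bdry * bool)%type [set p | open p.1]
  (fun p => if p.2 then [set S : CN | proj1_sig S `<=` p.1]
            else [set S : CN | proj1_sig S `&` p.1 !=set0]).
Local Notation CNm := (g_sigma_algebraType (@open CN)).



(* left action of a reduced word g (element of F_N) on the boundary *)
Definition canc (g : seq letter) (xi : bdry) : nat :=
  find (fun i => ~~ (proj1_sig xi i == linv (nth a0 g ((size g).-1 - i))))
       (iota 0 (size g)).
Definition actf (g : seq letter) (xi : bdry) : nat -> letter :=
  fun i => let m := (size g - canc g xi)%N in
    if (i < m)%N then nth a0 g i else proj1_sig xi (i - m + canc g xi)%N.
Definition actS (g : seq letter) (S : set bdry) : set bdry :=
  [set eta : bdry | exists xi, S xi /\ proj1_sig eta = actf g xi].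
(* g^{-1} U = the set of S in C_N with g S in U *)
Definition transl (g : seq letter) (U : set CN) : set CN :=
  [set S : CN | exists S' : CN, U S' /\ proj1_sig S' = actS g (proj1_sig S)].

(* finite subtrees of X, represented by their vertex sets *)
Definition tree_connected (T : {fset (seq letter)}) :=
  forall u v, u \in T -> v \in T -> exists p : seq (seq letter),
    [/\ path adjX u p, last u p = v & all (fun w => w \in T) p].
Definition SubX (T : {fset (seq letter)}) :=
  [/\ forall u, u \in T -> reduced u, (1 < #|` T|)%N & tree_connected T].
Definition deg (T : {fset (seq letter)}) (u : seq letter) : nat :=
  #|` [fset w in T | adjX u w]%fset|.
Definition termE (T : {fset (seq letter)}) (v u : seq letter) :=
  [/\ v \in T, u \in T, adjX v u & deg T u = 1%N].
(* Cyl(v,u): ends of geodesic rays starting with the oriented edge (v,u) *)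
Definition Cyl (v u : seq letter) : set bdry :=
  [set xi | exists x : nat -> seq letter,
     [/\ x 0%N = v, x 1%N = u, (forall k, reduced (x k)),
         (forall i j, dX (x i) (x j) = (i - j) + (j - i))%N &
         exists c1 c2, forall k, x (k + c1)%N = pref xi (k + c2)]].
Definition SCyl (T : {fset (seq letter)}) : set CN :=
  [set S : CN |
    (forall xi, proj1_sig S xi -> exists v u, termE T v u /\ Cyl v u xi) /\
    (forall v u, termE T v u -> exists xi, proj1_sig S xi /\ Cyl v u xi)].
Definition SubX1 (T : {fset (seq letter)}) := SubX T /\ [::] \in T.
Definition R1 : set {fset (seq letter)} :=
  [set T | [/\ SubX T, [::] \in T, (2 <= deg T [::])%N &
     forall u, u \in T -> deg T u = 1%N -> dX [::] u = 1%N]].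

Definition Ipre (U : set CN) : set (CNm * CNm) :=
  [set p | exists S : CN, U S /\ proj1_sig S = proj1_sig p.1 `&` proj1_sig p.2].

Section Currents.
Variable R : realType.
Local Open Scope ring_scope.
Local Open Scope ereal_scope.

Definition subset_current (mu : {measure set CNm -> \bar R}) :=
  (forall g, reduced g -> forall U : set CNm, measurable U ->
      mu (transl g U) = mu U) /\
  (forall K : set CN, compact K -> mu K < +oo).

Definition Vol (mu : {measure set CNm -> \bar R}) : \bar R :=
  (\esum_(T in R1) mu (SCyl T))%R.
End Currents.
End FreeGroup.

Notation CNm n := (g_sigma_algebraType (@open (CN n))).

(* Main.v *)
Require Import Defs.
From HB Require Import structures.
From mathcomp Require Import all_boot all_order all_algebra.
From mathcomp Require Import finmap zify.
From mathcomp Require Import all_classical all_reals all_analysis.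
From mathcomp Require Import measurable_realfun.
Set Implicit Arguments. Unset Strict Implicit. Unset Printing Implicit Defensive.
Import Order.TTheory GRing.Theory Num.Theory.
Local Open Scope classical_set_scope.

(** Let [E1] be the set of closed sets containing two ends with different
    first letters, that is, whose convex hull contains the vertex [1]. It is
    open and compact, its translates cover [CN], and it is the disjoint union of
    the cylinders of the stars in [R1]; hence a current is sigma-finite and
    gives [E1] mass at most [Vol]. If [S1 `&` S2] lies in [E1], so do [S1] and
    [S2], whence the product measure of [Ipre E1] is at most [Vol mu * Vol nu].
    This bounds every [SCyl T] with [1] in [T], since such a cylinder is
    contained in [E1], and every compact set, since finitely many translates of
    [E1] cover it and the product measure is invariant.

    Intersection is not continuous, but it is Borel: by compactness
    [S1 `&` S2] meets a clopen set [C] if and only if, for every [k], some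
    cylinder of depth [k] meets both [S1 `&` C] and [S2 `&` C]. *)

(** * The boundary of the tree *)

Lemma fset_nat_bound (I : choiceType) (f : I -> nat) (X : {fset I}) :
  exists K, forall i, i \in X -> (f i <= K)%N.
Proof.
exists (\max_(i <- X) f i) => i iX.
exact: (@leq_bigmax_seq _ _ predT).
Qed.

Section Boundary.
Context {n : nat}.
Implicit Types (xi eta : bdry n) (w : seq (letter n)) (k : nat).

Lemma bdry_ext xi eta : sval xi =1 sval eta -> xi = eta.
Proof.
case: xi eta => [f hf] [g hg] /= /funext fg.
by move: hg; rewrite -fg => hg; congr exist; exact: Prop_irrelevance.
Qed.

Lemma pref_eqP xi eta k :
  pref xi k = pref eta k <-> forall i, (i < k)%N -> sval xi i = sval eta i.
Proof.
split=> [e i ik|e]; last first.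
  by apply/eq_in_map => i; rewrite mem_iota add0n => /andP[_]; exact: e.
by rewrite -(nth_mkseq (a0 n) (sval xi) ik) -/(pref xi k) e nth_mkseq.
Qed.

Lemma size_pref xi k : size (pref xi k) = k.
Proof. exact: size_mkseq. Qed.

Lemma pref_le xi eta j k : (j <= k)%N -> pref xi k = pref eta k ->
  pref xi j = pref eta j.
Proof.
by move=> jk /pref_eqP e; apply/pref_eqP => i ij; apply: e; exact: leq_trans jk.
Qed.

Definition cyl w := [set xi : bdry n | pref xi (size w) = w].

Lemma cyl_pref xi k eta : cyl (pref xi k) eta <-> pref eta k = pref xi k.
Proof. by rewrite /cyl /= size_pref. Qed.

Lemma open_cyl_pref xi k : open (cyl (pref xi k)).
Proof.
exists [set cyl (pref xi k)]; last by rewrite bigcup_set1.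
move=> _ ->; exists [fset (k, xi)]%fset; first by move=> p _; rewrite inE.
rewrite set_fset1 bigcap_set1 /=.
by apply/seteqP; split=> eta /cyl_pref.
Qed.

(** Finitely many prefix conditions satisfied by [xi] all follow from the longest one, so the
    cylinders form a neighbourhood base and not merely a subbase. *)
Lemma nbhs_bdryP xi (A : set (bdry n)) :
  nbhs xi A <-> exists k, cyl (pref xi k) `<=` A.
Proof.
split; last first.
  move=> [k kA]; apply: (filterS kA); apply: open_nbhs_nbhs.
  by split; [exact: open_cyl_pref|exact/cyl_pref].
rewrite nbhsE => -[B [[D' sD' <-] [C D'C Cxi]] sBA].
suff [k sk] : exists k, cyl (pref xi k) `<=` C.
  by exists k => eta /sk Ceta; apply: sBA; exists C.
have [X _ XC] := sD' _ D'C; rewrite -XC in Cxi *.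
have [K KP] := fset_nat_bound (fun p => fst p : nat) X.
exists K => eta /cyl_pref e p /= pX.
by rewrite -(Cxi _ pX); apply: pref_le e; exact: KP.
Qed.

Lemma open_cyl w : open (cyl w).
Proof.
rewrite openE => xi wxi; apply/nbhs_bdryP; exists (size w) => eta /cyl_pref.
by rewrite /cyl /= wxi.
Qed.

Lemma closed_cyl w : closed (cyl w).
Proof.
rewrite -openC openE => xi wxi; apply/nbhs_bdryP.
by exists (size w) => eta /cyl_pref e weta; apply: wxi; rewrite /cyl /= -e.
Qed.

(** Otherwise [F] would contain the complements of all fibres, and these finitely many sets have
    empty intersection. *)
Lemma ultra_fin (T : Type) (F : set_system T) (I : finType) (f : T -> I) :
  UltraFilter F -> exists i, F [set t | f t = i].
Proof.
move=> UF; apply: contrapT => /forallNP h.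
suff : F set0 by exact: filter_not_empty.
have : \forall t \near F, forall i, (~` [set t | f t = i]) t.
  apply: filter_forall => i.
  by have [/h|] := in_ultra_setVsetC [set t | f t = i] UF.
by apply: filterS => t /(_ (f t)); apply.
Qed.

(** An ultrafilter settles each letter, since the alphabet is finite. The limit word is reduced
    because any two consecutive letters of it occur together in some actual end. *)
Lemma compact_bdry : compact [set: bdry n].
Proof.
rewrite compact_ultra => F UF _.
have /choice[x xP] : forall k, exists a, F [set xi : bdry n | sval xi k = a].
  by move=> k; exact: ultra_fin.
have rx k : x k.+1 != linv (x k).
  have [xi [/= <- <-]] := filter_ex (filterI (xP k.+1) (xP k)).
  exact: (svalP xi).
exists (exist _ x rx); split=> // A /nbhs_bdryP[k kA]; apply: (filterS kA).
elim: k {kA} => [|k ih]; first by apply: filterS filterT => xi _; exact/cyl_pref.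
apply: filterS (filterI ih (xP k)) => xi [/cyl_pref/pref_eqP e /= ek].
apply/cyl_pref/pref_eqP => i; rewrite ltnS leq_eqVlt => /predU1P[->//|].
exact: e.
Qed.

Lemma closed_compact_bdry (C : set (bdry n)) : closed C -> compact C.
Proof. by move=> cC; exact: (subclosed_compact cC compact_bdry). Qed.

Lemma bdry_neqP xi eta : xi <> eta -> exists k, pref xi k <> pref eta k.
Proof.
move=> ne; apply: contrapT => /forallNP h; apply: ne; apply: bdry_ext => k.
by have /contrapT/pref_eqP/(_ k (ltnSn k)) := h k.+1.
Qed.

Lemma hausdorff_bdry : hausdorff_space (bdry n).
Proof.
move=> xi eta cl; apply: contrapT => /bdry_neqP[k].
have [||z [/cyl_pref <- /cyl_pref <-]//] :=
  cl (cyl (pref xi k)) (cyl (pref eta k)).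
- by apply/nbhs_bdryP; exists k.
- by apply/nbhs_bdryP; exists k.
Qed.

End Boundary.

(** * The Vietoris topology *)

Section Hyperspace.
Context {n : nat}.
Implicit Types (xi eta : bdry n) (w : seq (letter n)) (k : nat).
Implicit Types (S : CN n) (O C : set (bdry n)).

Lemma closed_CN S : closed (sval S).
Proof. by case: (svalP S). Qed.

Lemma CN_ext S S' : sval S = sval S' -> S = S'.
Proof.
case: S S' => [A hA] [B hB] /= AB; move: hB; rewrite -AB => hB.
by congr exist; exact: Prop_irrelevance.
Qed.

Definition inCN O : set (CN n) := [set S | sval S `<=` O].
Definition meetCN O : set (CN n) := [set S | sval S `&` O !=set0].

Lemma open_subbase_CN (p : set (bdry n) * bool) : open p.1 ->
  open (if p.2 then inCN p.1 else meetCN p.1).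
Proof.
move=> oO; exists [set if p.2 then inCN p.1 else meetCN p.1]; last first.
  by rewrite bigcup_set1.
move=> _ ->; exists [fset p]%fset.
  by move=> q; rewrite !inE => /eqP ->.
by rewrite set_fset1 bigcap_set1.
Qed.

Lemma open_inCN O : open O -> open (inCN O).
Proof. exact: (@open_subbase_CN (O, true)). Qed.

Lemma open_meetCN O : open O -> open (meetCN O).
Proof. exact: (@open_subbase_CN (O, false)). Qed.

(** Convergence has only to be tested on the Vietoris subbase. *)
Lemma cvg_CN (F : set_system (CN n)) S : Filter F ->
  (forall O, open O -> sval S `<=` O -> F (inCN O)) ->
  (forall O, open O -> sval S `&` O !=set0 -> F (meetCN O)) ->
  F --> S.
Proof.
move=> FF Fin Fmeet A; rewrite nbhsE => -[B [[D' sD' <-] [X D'X XS]] sBA].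
suff FX : F X by apply: filterS FX => S' XS'; apply: sBA; exists X.
have [Y YD YX] := sD' _ D'X; rewrite -YX in XS *.
apply: filter_bigI => p pY; have /set_mem := YD _ pY; case: p pY => O [] pY oO.
  by apply: Fin => //; exact: (XS _ pY).
by apply: Fmeet => //; exact: (XS _ pY).
Qed.

(** The limit of an ultrafilter in the hyperspace of all closed sets; it may
    be a singleton, hence not a point of [CN]. *)
Definition limset (F : set_system (CN n)) : set (bdry n) :=
  [set xi | forall k, F (meetCN (cyl (pref xi k)))].

Lemma closed_limset F : closed (limset F).
Proof.
rewrite -openC openE => xi /existsNP[k nk]; apply/nbhs_bdryP; exists k.
by move=> eta /cyl_pref e /(_ k); rewrite e.
Qed.

(** Each point of [C] has a cylinder that [F]-almost every set misses; by compactness of [C],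
    finitely many such cylinders suffice. *)
Lemma limset_disjoint (F : set_system (CN n)) C : UltraFilter F -> closed C ->
  limset F `&` C = set0 -> F (inCN (~` C)).
Proof.
move=> UF cC LC0.
have /compact_near_coveringP/(_ _ F (fun S x => ~ sval S x)) cov :=
  closed_compact_bdry cC.
have : \near F, C `<=` (fun x => ~ sval F x).
  apply: cov => x Cx.
  have /existsNP[k nk] : ~ limset F x by move=> Lx; rewrite -[False]/(set0 x) -LC0.
  exists (cyl (pref x k), ~` meetCN (cyl (pref x k))) => /=.
    split; first by apply/nbhs_bdryP; exists k.
    by have [/nk|] := in_ultra_setVsetC (meetCN (cyl (pref x k))) UF.
  by move=> [x' S] /= [xx' nS] Sx'; apply: nS; exists x'.
by apply: filterS => S CS x Sx /CS; apply.
Qed.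

Lemma cvg_limset (F : set_system (CN n)) S : UltraFilter F ->
  sval S = limset F -> F --> S.
Proof.
move=> UF SL; apply: cvg_CN => O oO.
  rewrite SL => LO; rewrite -(setCK O); apply: limset_disjoint.
    by rewrite closedC.
  by apply/seteqP; split=> // x [/LO].
move=> [x []]; rewrite SL => Lx Ox.
have /nbhs_bdryP[k kO] : nbhs x O by apply: open_nbhs_nbhs.
by apply: filterS (Lx k) => S' [y [S'y /kO Oy]]; exists y.
Qed.

Definition E1 : set (CN n) :=
  [set S | exists xi eta, [/\ sval S xi, sval S eta & sval xi 0%N != sval eta 0%N]].

Lemma pref1_eqP xi eta : pref xi 1 = pref eta 1 <-> sval xi 0%N = sval eta 0%N.
Proof.
rewrite pref_eqP; split; first by apply.
by move=> e [].
Qed.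

(** The limit set of an ultrafilter is closed; what could fail is having two points. If it lay in a
    single first-letter cylinder, then so would [F]-almost every set, contrary to membership in
    [E1]. *)
Lemma compact_E1 : compact E1.
Proof.
rewrite compact_ultra => F UF FE1.
have L0 : limset F !=set0.
  apply/set0P/eqP => L0.
  have FT : F (inCN (~` setT)).
    by apply: limset_disjoint; [exact: closedT|rewrite L0 set0I].
  have [S] := filter_ex FT; rewrite setCT /inCN /= => S0.
  by case: (svalP S) => _ [x [y [/S0]]].
have [x Lx] := L0.
have [y [Ly yx]] : exists y, limset F y /\ sval y 0%N <> sval x 0%N.
  apply: contrapT => /forallNP h.
  have Fx : F (inCN (~` ~` (cyl (pref x 1)))).
    apply: limset_disjoint; first by rewrite closedC; exact: open_cyl.
    apply/seteqP; split=> // y [Ly nxy]; apply: (h y); split=> //.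
    by move=> yx; apply: nxy; exact/cyl_pref/pref1_eqP.
  have [S [[u [v [Su Sv /eqP uv]]]]] := filter_ex (filterI FE1 Fx).
  rewrite setCK /inCN /= => Sx; apply: uv.
  by apply/pref1_eqP; have /cyl_pref -> := Sx _ Su; have /cyl_pref -> := Sx _ Sv.
have two : closed (limset F) /\ exists x y, limset F x /\ limset F y /\ x <> y.
  split; first exact: closed_limset.
  by exists x, y; split=> //; split=> // xy; apply: yx; rewrite xy.
exists (exist _ _ two : CN n); split; last exact: cvg_limset.
by exists y, x; split=> //; exact/eqP.
Qed.

Lemma E1E : E1 = \bigcup_(a : letter n) \bigcup_(b in [set b | a != b])
  (meetCN (cyl [:: a]) `&` meetCN (cyl [:: b])).
Proof.
apply/seteqP; split=> S.
  move=> [x [y [Sx Sy xy]]]; exists (sval x 0%N) => //.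
  by exists (sval y 0%N) => //; split; [exists x|exists y].
move=> [a _ [b ab [[x [Sx [xa]]] [y [Sy [yb]]]]]].
by exists x, y; split=> //; rewrite xa yb.
Qed.

Lemma open_E1 : open E1.
Proof.
rewrite E1E; apply: bigcup_open => a _; apply: bigcup_open => b _.
by apply: openI; apply: open_meetCN; exact: open_cyl.
Qed.

(** A point of [S] outside [S'] has a cylinder disjoint from [S']; meeting this cylinder and
    avoiding it are disjoint open conditions. This makes compact sets closed, hence Borel. *)
Lemma hausdorff_CN : hausdorff_space (CN n).
Proof.
suff main S S' x : cluster (nbhs S) S' -> sval S x -> sval S' x.
  move=> S S' cl; apply: CN_ext; apply/seteqP; split=> x.
    exact: main cl.
  by apply: main => A B nA nB; rewrite setIC; exact: cl.
move=> cl Sx; apply: contrapT => nS'x.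
have /nbhs_bdryP[k kS'] : nbhs x (~` sval S').
  by apply: open_nbhs_nbhs; split=> //; rewrite openC; exact: closed_CN.
have [||T [[y [Ty xy]] /(_ y Ty)]] :=
  cl (meetCN (cyl (pref x k))) (inCN (~` cyl (pref x k))).
- apply: open_nbhs_nbhs; split; first by apply: open_meetCN; exact: open_cyl.
  by exists x; split=> //; exact/cyl_pref.
- apply: open_nbhs_nbhs; split.
    by apply: open_inCN; rewrite openC; exact: closed_cyl.
  by move=> z S'z /kS'.
- by apply.
Qed.

(** The approximation of [A] at depth [k]. Its values lie in a finite type, so conditions on it
    split into finite unions. *)
Definition ptype k (A : set (bdry n)) : {set k.-tuple (letter n)} :=
  [set t : k.-tuple (letter n) | `[< A `&` cyl t !=set0 >]].

Lemma ptypeP k A (t : k.-tuple (letter n)) :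
  reflect (A `&` cyl t !=set0) (t \in ptype k A).
Proof. by rewrite inE; exact: asboolP. Qed.

Definition tpref xi k : k.-tuple (letter n) := Tuple (introT eqP (size_pref xi k)).

Lemma ptype_pref k A xi : A xi -> tpref xi k \in ptype k A.
Proof. by move=> Axi; apply/ptypeP; exists xi; split=> //; exact/cyl_pref. Qed.

Lemma ptype_le j k (A B : set (bdry n)) : (j <= k)%N -> ptype k A = ptype k B ->
  forall x, A x -> exists2 y, B y & pref y j = pref x j.
Proof.
move=> jk e x /(ptype_pref k); rewrite e => /ptypeP[y [By /cyl_pref xy]].
by exists y => //; exact: pref_le xy.
Qed.

(** A Lebesgue number lemma: the depth that works at one point works nearby, and compactness makes
    it uniform. *)
Lemma compact_uniform_cyl C O : compact C -> open O -> C `<=` O ->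
  exists k, forall x, C x -> cyl (pref x k) `<=` O.
Proof.
move=> /compact_near_coveringP cC oO CO.
have [|k _ /(_ k (leqnn k))] :=
  cC _ \oo%classic (fun k x => cyl (pref x k) `<=` O) _; last by exists k.
move=> x /CO Ox; have /nbhs_bdryP[k kO] : nbhs x O by apply: open_nbhs_nbhs.
exists (cyl (pref x k), [set m | (k <= m)%N]) => /=.
  by split; [apply/nbhs_bdryP; exists k|exists k].
move=> [y m] /= [/cyl_pref xy km] z /cyl_pref yz; apply: kO; apply/cyl_pref.
by rewrite -xy; exact: pref_le yz.
Qed.

(** The sets of equal type at depth [k] generate a filter converging to [S]: inclusion in an open
    set is detected at a uniform depth because [S] is compact, and meeting an open set is detected
    at the depth of a single cylinder. *)
Lemma ptype_base (U : set (CN n)) S : open U -> U S ->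
  exists k, forall S', ptype k (sval S') = ptype k (sval S) -> U S'.
Proof.
move=> oU US.
pose B k := [set S' : CN n | ptype k (sval S') = ptype k (sval S)].
have BF : Filter (filter_from setT B).
  apply: filter_from_filter; first by exists 0%N.
  move=> i j _ _; exists (maxn i j) => // S' e.
  have le_type l m : (l <= m)%N ->
      ptype m (sval S') = ptype m (sval S) -> ptype l (sval S') = ptype l (sval S).
    move=> lm e'; apply/setP => t; apply/ptypeP/ptypeP => -[x [Sx xt]].
      have [y Sy yx] := ptype_le lm e' Sx; exists y; split=> //.
      by move: xt; rewrite /cyl /= size_tuple yx.
    have [y Sy yx] := ptype_le lm (esym e') Sx; exists y; split=> //.
    by move: xt; rewrite /cyl /= size_tuple yx.
  by split; [apply: le_type e; exact: leq_maxl|apply: le_type e; exact: leq_maxr].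
suff /(_ U) : filter_from setT B --> S.
  by case=> [|k _ kU]; [exact: open_nbhs_nbhs|exists k].
apply: cvg_CN => O oO.
  move=> /(compact_uniform_cyl (closed_compact_bdry (@closed_CN S)) oO)[k kO].
  exists k => // S' e x S'x.
  have [y Sy yx] := ptype_le (leqnn k) e S'x.
  by apply: (kO _ Sy); exact/cyl_pref.
move=> [x [Sx Ox]]; have /nbhs_bdryP[k kO] : nbhs x O by apply: open_nbhs_nbhs.
exists k => // S' e; have [y Sy yx] := ptype_le (leqnn k) (esym e) Sx.
by exists y; split=> //; apply: kO; exact/cyl_pref.
Qed.

End Hyperspace.

(** * Measurability of the intersection map *)

Section Intersection.
Context {n : nat}.
Implicit Types (C : set (bdry n)) (U : set (CN n)).

Lemma measurable_openCN U : open U -> measurable (U : set (CNm n)).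
Proof. by move=> oU; exact: sub_sigma_algebra. Qed.

Definition capI (p : CNm n * CNm n) : set (bdry n) := sval p.1 `&` sval p.2.

Lemma closed_capI p : closed (capI p).
Proof. by apply: closedI; exact: closed_CN. Qed.

Definition meetI C : set (CNm n * CNm n) := [set p | capI p `&` C !=set0].

Lemma meetIE C : closed C -> meetI C =
  \bigcap_k \bigcup_(t : k.-tuple (letter n))
    (meetCN (cyl t `&` C) `*` meetCN (cyl t `&` C)).
Proof.
move=> cC; apply/seteqP; split=> [p [x [[x1 x2] Cx]] k _|p h].
  exists (tpref x k) => //; split; exists x; split=> //; split=> //;
  exact/cyl_pref.
(* If the intersection misses [C], the compact set [sval p.1]&[C] lies in the open complement of
   [sval p.2], so some depth [k] separates the two and contradicts [h k]. *)
apply: contrapT => p0.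
have cpt : compact (sval p.1 `&` C).
  by apply: closed_compact_bdry; apply: closedI => //; exact: closed_CN.
have oC : open (~` sval p.2) by rewrite openC; exact: closed_CN.
have [|k kP] := compact_uniform_cyl cpt oC.
  by move=> x [x1 Cx] x2; apply: p0; exists x; split.
have [t _ [[x [x1 [xt Cx]]] [y [y2 [yt _]]]]] := h k Logic.I.
apply: (kP x _ y) => //; apply/cyl_pref.
by move: xt yt; rewrite /cyl /= size_tuple => -> ->.
Qed.

Lemma measurable_meetI C : open C -> closed C -> measurable (meetI C).
Proof.
move=> oC cC; rewrite meetIE //; apply: bigcapT_measurable => k.
apply: fin_bigcup_measurable; first exact: finite_finset.
move=> t _; apply: measurableX; apply: measurable_openCN; apply: open_meetCN;
  by apply: openI => //; exact: open_cyl.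
Qed.

Lemma measurable_meetI_cyl w : measurable (meetI (cyl w)).
Proof. by apply: measurable_meetI; [exact: open_cyl|exact: closed_cyl]. Qed.

(** The domain of the intersection map: intersections are always closed, so having two points is the
    only condition for landing in [CN]. *)
Definition twoI : set (CNm n * CNm n) :=
  [set p | exists x y, capI p x /\ capI p y /\ x <> y].

Lemma measurable_twoI : measurable twoI.
Proof.
have -> : twoI = \bigcup_k \bigcup_(t : k.-tuple (letter n))
    \bigcup_(s in [set s : k.-tuple (letter n) | s != t])
      (meetI (cyl t) `&` meetI (cyl s)).
  apply/seteqP; split=> p.
    move=> [x [y [px [py /bdry_neqP[k xy]]]]]; exists k => //.
    exists (tpref x k) => //; exists (tpref y k).
      by apply/eqP => /(congr1 val) /= yx; apply: xy.
    by split; [exists x|exists y]; split=> //; exact/cyl_pref.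
  move=> [k _ [t _ [s /eqP st [[x [px xt]] [y [py ys]]]]]].
  exists x, y; split=> //; split=> // xy; apply: st; apply: val_inj => /=.
  by move: xt ys; rewrite /cyl /= !size_tuple xy => -> ->.
apply: bigcupT_measurable => k.
apply: fin_bigcup_measurable => [|t _]; first exact: finite_finset.
apply: fin_bigcup_measurable => [|s _]; first exact: finite_finset.
by apply: measurableI; exact: measurable_meetI_cyl.
Qed.

Lemma measurable_ptypeI k (A : {set k.-tuple (letter n)}) :
  measurable [set p | ptype k (capI p) = A].
Proof.
have -> : [set p | ptype k (capI p) = A] =
    \bigcap_t (if t \in A then meetI (cyl t) else ~` meetI (cyl t)).
  apply/seteqP; split=> p.
    move=> /= <- t _; case: ifPn => /ptypeP //.
  move=> h; apply/setP => t; have := h t Logic.I.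
  case: ifPn => _ /=; first by move=> ?; apply/ptypeP.
  by move=> h'; apply/negbTE/ptypeP.
apply: fin_bigcap_measurable; first exact: finite_finset.
move=> t _; case: ifP => _; last apply: measurableC;
  exact: measurable_meetI_cyl.
Qed.

Lemma measurable_Ipre_open U : open U -> measurable (Ipre U).
Proof.
move=> oU.
(* [AA k] collects the types at depth [k] that force membership in [U]; by [ptype_base] every member
   of [U] has such a type at some depth. *)
pose AA k := [set A | forall S, ptype k (sval S) = A -> U S].
have -> : Ipre U = twoI `&`
    \bigcup_k \bigcup_(A in AA k) [set p | ptype k (capI p) = A].
  apply/seteqP; split=> p.
    move=> [S [US Sp]]; split.
      by have [_] := svalP S; rewrite Sp.
    have [k kU] := ptype_base oU US; exists k => //.
    by exists (ptype k (sval S)) => //=; rewrite Sp.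
  move=> [two [k _ [A AAk] /= pA]].
  exists (exist _ (capI p) (conj (@closed_capI p) two)); split=> //.
  exact: AAk.
apply: measurableI; first exact: measurable_twoI.
apply: bigcupT_measurable => k.
apply: fin_bigcup_measurable => [|A _]; first exact: finite_finset.
exact: measurable_ptypeI.
Qed.

(** [Ipre] is a preimage under a partial map, so complements are taken inside its domain
    [Ipre setT]. *)
Lemma Ipre_setC U : Ipre (~` U) = Ipre setT `\` Ipre U.
Proof.
apply/seteqP; split=> p.
  move=> [S [nUS Sp]]; split; first by exists S.
  by move=> [S' [US' S'p]]; apply: nUS; rewrite (@CN_ext _ S S') // Sp S'p.
move=> [[S [_ Sp]] np]; exists S; split=> // US; apply: np.
by exists S.
Qed.

Lemma Ipre_bigcup (F : nat -> set (CN n)) :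
  Ipre (\bigcup_k F k) = \bigcup_k Ipre (F k).
Proof.
apply/seteqP; split=> p; first by move=> [S [[k _ FS] Sp]]; exists k => //; exists S.
by move=> [k _ [S [FS Sp]]]; exists S; split=> //; exists k.
Qed.

Lemma Ipre0 : Ipre (@set0 (CN n)) = set0.
Proof. by apply/seteqP; split=> // p [S []]. Qed.

Lemma IpreS U U' : U `<=` U' -> Ipre U `<=` Ipre U'.
Proof. by move=> UU' p [S [/UU' ? ?]]; exists S. Qed.

Lemma Ipre_trivIset (F : nat -> set (CN n)) : trivIset setT F ->
  trivIset setT (fun k => Ipre (F k)).
Proof.
move=> tF i j _ _ [p [[S [FS Sp]] [S' [FS' S'p]]]]; apply: tF => //.
by exists S; split=> //; rewrite (@CN_ext _ S S') // Sp S'p.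
Qed.

(** The sets with measurable preimage form a sigma-algebra containing the open sets. *)
Lemma measurable_Ipre (U : set (CNm n)) : measurable U -> measurable (Ipre U).
Proof.
move: U; apply: (@smallest_sub _ _ _ [set U : set (CN n) | measurable (Ipre U)]).
  split=> /=.
  - by rewrite Ipre0.
  - move=> A mA; rewrite setTD Ipre_setC; apply: measurableD => //.
    by apply: measurable_Ipre_open; exact: openT.
  - by move=> F mF; rewrite Ipre_bigcup; exact: bigcupT_measurable.
by move=> U oU; exact: measurable_Ipre_open.
Qed.

End Intersection.

(** * The action of the free group *)

Section Action.
Context {n : nat}.
Implicit Types (a : letter n) (g : seq (letter n)) (xi eta : bdry n).

Lemma linvK : involutive (@linv n).
Proof. by case=> i b; rewrite /linv /= negbK. Qed.

Lemma neq_linv a : a != linv a.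
Proof. by case: a => i []; rewrite /linv xpair_eqE /= andbF. Qed.

(** The action of a single letter. Building the action letter by letter makes injectivity and
    continuity immediate; [actE] then identifies it with the closed formula [actf]. *)
Definition actl_fun a xi (k : nat) : letter n :=
  if sval xi 0%N == linv a then sval xi k.+1
  else if k is k'.+1 then sval xi k' else a.

Lemma actl_reduced a xi k : actl_fun a xi k.+1 != linv (actl_fun a xi k).
Proof.
rewrite /actl_fun; case: ifPn => [_|h]; first exact: (svalP xi).
by case: k => [//|k]; exact: (svalP xi).
Qed.

Definition actl a xi : bdry n := exist _ (actl_fun a xi) (actl_reduced a xi).

Lemma actlK a : cancel (actl a) (actl (linv a)).
Proof.
move=> xi; apply: bdry_ext => k; rewrite /= /actl_fun /= /actl_fun linvK.
case: (eqVneq (sval xi 0%N) (linv a)) => [e|ne]; last by rewrite eqxx.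
have := svalP xi 0%N; rewrite e linvK => /negbTE ->.
by case: k => [|k] //; rewrite e.
Qed.

Lemma pref_actl a xi eta k : pref xi k.+1 = pref eta k.+1 ->
  pref (actl a xi) k = pref (actl a eta) k.
Proof.
move=> /pref_eqP e; apply/pref_eqP => i ik; rewrite /= /actl_fun -(e 0%N) //.
by case: ifP => _; [exact: e|case: i ik => [//|i] ik; apply: e; exact: ltnW (ltnW ik)].
Qed.

Lemma continuous_actl a : continuous (actl a).
Proof.
move=> xi A /nbhs_bdryP[k kA]; apply/nbhs_bdryP; exists k.+1.
by move=> eta /cyl_pref e; apply: kA; apply/cyl_pref; exact: pref_actl.
Qed.

Definition act g xi : bdry n := foldr actl xi g.

Lemma act_inj g : injective (act g).
Proof.
by elim: g => [//|a g ih] xi eta /= /(can_inj (actlK a)); exact: ih.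
Qed.

Lemma continuous_act g : continuous (act g).
Proof.
elim: g => [|a g ih] xi; first exact: cvg_id.
by apply: continuous_comp; [exact: ih|exact: continuous_actl].
Qed.

Lemma canc_le g xi : (canc g xi <= size g)%N.
Proof. by rewrite -[leqRHS](size_iota 0); exact: find_size. Qed.

(** Cancellation eats [g] from its right end, so the new letter [a] is reached only after the whole
    of [g] has cancelled. *)
Lemma canc_cons a g xi : canc (a :: g) xi =
  if (canc g xi == size g) && (sval xi (size g) == linv a) then (size g).+1
  else canc g xi.
Proof.
rewrite /canc [size (a :: g)]/= -[(size g).+1]addn1 iotaD find_cat size_iota.
set p := (X in find X _).
have pq : {in iota 0 (size g), p =1 (fun i =>
    ~~ (sval xi i == linv (nth (a0 n) g ((size g).-1 - i))))}.
  move=> i; rewrite mem_iota add0n /= => ig; rewrite /p addn1 /=.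
  case e : (size g - i)%N => [|m]; first by move: ig; rewrite -subn_gt0 e.
  by rewrite /= (_ : (size g).-1 - i = m)%N // -subn1 subnAC e subn1.
rewrite -(eq_in_find pq) has_find size_iota.
have := find_size p (iota 0 (size g)); rewrite size_iota leq_eqVlt.
move=> /predU1P[e|lt]; last by rewrite lt (ltn_eqF lt).
rewrite e ltnn eqxx /=.
rewrite add0n /p addn1 /= subnn /=.
by case: eqP => _ /=; rewrite ?addn1 ?addn0.
Qed.

(** While part of [g] survives, its first letter heads the product, and reducedness of [a :: g]
    forbids cancelling it with [a]. Only after total cancellation does [a] meet a letter of [xi]. *)
Lemma actE g xi : reduced g -> sval (act g xi) = actf g xi.
Proof.
elim: g => [|a g ih] rg; first by apply/funext => i; rewrite /actf /= subn0 addn0.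
have {}ih : sval (act g xi) = actf g xi by apply: ih; exact: path_sorted rg.
apply/funext => i; rewrite /= /actl_fun ih /actf canc_cons [size (a :: g)]/=.
have := canc_le g xi; rewrite leq_eqVlt => /predU1P[e|lt].
  rewrite e eqxx subnn ltn0 add0n; case: ifPn => /= [h|h].
    by rewrite subnn ltn0 !subn0 addnS addSn.
  rewrite subSnn; case: i => [//|i]; rewrite ltnS ltn0 /=.
  by rewrite subn1 /= subn0.
have m0 : (0 < size g - canc g xi)%N by rewrite subn_gt0.
rewrite (ltn_eqF lt) /= m0.
have -> : (nth (a0 n) g 0 == linv a) = false.
  by case: g rg lt {ih m0} => [//|b g] /= /andP[/negbTE].
case: i => [|i]; first by rewrite subn_gt0 (leq_trans lt).
rewrite subSn; last exact: ltnW.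
by rewrite ltnS subSS.
Qed.

Lemma actSE g (A : set (bdry n)) : reduced g -> actS g A = act g @` A.
Proof.
move=> rg; apply/seteqP; split=> eta.
  by move=> [xi [Axi e]]; exists xi => //; apply: bdry_ext => k; rewrite actE // e.
by move=> [xi Axi <-]; exists xi; split=> //; exact: actE.
Qed.

Lemma actCN_subproof g (S : CN n) : closed (act g @` sval S) /\
  exists x y, (act g @` sval S) x /\ (act g @` sval S) y /\ x <> y.
Proof.
split.
  apply: compact_closed; first exact: hausdorff_bdry.
  apply: continuous_compact; last by apply: closed_compact_bdry; exact: closed_CN.
  by apply: continuous_subspaceT; exact: continuous_act.
case: (svalP S) => _ [x [y [Sx [Sy xy]]]]; exists (act g x), (act g y).
by split; [exists x|split; [exists y|move=> /act_inj]].
Qed.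

Definition actCN g (S : CN n) : CN n := exist _ _ (actCN_subproof g S).

Lemma translE g (U : set (CN n)) : reduced g -> transl g U = actCN g @^-1` U.
Proof.
move=> rg; apply/seteqP; split=> S.
  move=> [S' [US' e]]; rewrite /preimage /=.
  by have -> // : actCN g S = S' by apply: CN_ext; rewrite e actSE.
by move=> US; exists (actCN g S); split=> //; rewrite actSE.
Qed.

Lemma continuous_actCN g : continuous (actCN g).
Proof.
have /continuousP oact := @continuous_act g.
move=> S; have FF : Filter (actCN g x @[x --> S]) by apply: fmap_filter; exact: nbhs_filter.
apply: cvg_CN => O oO.
  move=> SO; have : open_nbhs S (inCN (act g @^-1` O)).
    split; first by apply: open_inCN; exact: oact.
    by move=> x Sx; apply: SO; exists x.
  move=> /open_nbhs_nbhs; apply: filterS => S' S'O _ [x S'x <-].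
  exact: S'O.
move=> [_ [[x Sx <-] Ox]]; have : open_nbhs S (meetCN (act g @^-1` O)).
  by split; [apply: open_meetCN; exact: oact|exists x].
move=> /open_nbhs_nbhs; apply: filterS => S' [y [S'y Oy]].
by exists (act g y); split=> //; exists y.
Qed.

Lemma measurable_actCN g : measurable_fun setT (actCN g : CNm n -> CNm n).
Proof.
apply: (@measurability _ _ (CNm n) (CNm n) setT (actCN g) (@open (CN n)) erefl).
move=> _ [U oU <-]; rewrite setTI; apply: measurable_openCN.
by have /continuousP := @continuous_actCN g; apply.
Qed.

(** Injectivity of the action makes it commute with intersection. *)
Lemma Ipre_actCN g (U : set (CN n)) (p : CNm n * CNm n) :
  Ipre (actCN g @^-1` U) p <-> Ipre U (actCN g p.1, actCN g p.2).
Proof.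
have capE : (act g @` sval p.1) `&` (act g @` sval p.2) = act g @` capI p.
  apply/seteqP; split=> x.
    by move=> [[y y1 <-] [z z2 /act_inj zy]]; exists y => //; split=> //; rewrite -zy.
  by move=> [y [y1 y2] <-]; split; exists y.
split=> [[S [US Sp]]|[S [US]]] /=.
  by exists (actCN g S); split=> //=; rewrite Sp capE.
rewrite capE => Sp.
have two : exists x y, capI p x /\ capI p y /\ x <> y.
  case: (svalP S) => _; rewrite Sp => -[_ [_ [[x px <-] [[y py <-] xy]]]].
  by exists x, y; split=> //; split=> // e; apply: xy; rewrite e.
pose S0 : CN n := exist _ (capI p) (conj (@closed_capI _ p) two).
exists S0; split=> //; have -> // : (actCN g @^-1` U) S0 = U S.
by congr U; apply: CN_ext; rewrite Sp.
Qed.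

Lemma reduced_winv g : reduced g -> reduced (winv g).
Proof.
rewrite /reduced /winv rev_sorted sorted_map; apply: sub_sorted => a b /=.
by rewrite linvK eq_sym.
Qed.

Lemma reduced_pref xi k : reduced (pref xi k).
Proof.
apply: (path_sorted (x := sval xi 0%N)); rewrite /pref /mkseq.
apply/(pathP (a0 n)) => i; rewrite size_map size_iota => ik.
rewrite (nth_map 0%N) ?size_iota // nth_iota // add0n.
case: i ik => [|i] ik /=; first exact: neq_linv.
rewrite (nth_map 0%N) ?size_iota ?(ltnW ik)// nth_iota ?(ltnW ik)// add0n.
exact: (svalP xi).
Qed.

Lemma pref_rcons xi k : pref xi k.+1 = rcons (pref xi k) (sval xi k).
Proof. exact: mkseqS. Qed.

Lemma act_winv_pref xi k i :
  sval (act (winv (pref xi k)) xi) i = sval xi (k + i)%N.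
Proof.
elim: k i => [//|k ih] i.
rewrite pref_rcons /winv map_rcons rev_rcons -/(winv _) /= /actl_fun.
by rewrite !ih addn0 linvK eqxx addSnnS.
Qed.

(** Take two ends of [S] and translate by the inverse of their longest common prefix: the translated
    ends differ in their first letter. *)
Lemma exists_act_E1 (S : CN n) : exists2 g, reduced g & E1 (actCN g S).
Proof.
case: (svalP S) => _ [x [y [Sx [Sy /bdry_neqP xy]]]].
have exk : exists k, pref x k != pref y k by have [k /eqP] := xy; exists k.
have [k ne kmin] := ex_minnP exk.
case: k ne kmin => [/eqP//|k] ne kmin.
have e : pref x k = pref y k.
  by apply/eqP; apply: contraT => /kmin; rewrite ltnn.
exists (winv (pref x k)); first exact/reduced_winv/reduced_pref.
exists (act (winv (pref x k)) x), (act (winv (pref x k)) y); split.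
- by exists x.
- by exists y.
rewrite act_winv_pref e act_winv_pref addn0; apply: contra ne => /eqP xyk.
by rewrite !pref_rcons e xyk.
Qed.

End Action.

(** * The word metric and cylinders *)

Section Words.
Context {n : nat}.
Implicit Types (a b : letter n) (p s t u v w r : seq (letter n)).

Lemma reduced_catl s t : reduced (s ++ t) -> reduced s.
Proof. by case: s => [//|a s]; rewrite /reduced /= cat_path => /andP[]. Qed.

Lemma reduced_catr s t : reduced (s ++ t) -> reduced t.
Proof.
elim: s => [//|a s ih]; rewrite /reduced cat_cons => /path_sorted; exact: ih.
Qed.

Lemma reduced_push a r : reduced r -> reduced (push a r).
Proof.
case: r => [//|b r] rr; rewrite /push; case: ifPn => h; first exact: path_sorted rr.
by rewrite /reduced /= h.
Qed.

Lemma pushK a r : reduced r -> push (linv a) (push a r) = r.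
Proof.
case: r => [|b r] rr /=; first by rewrite linvK eqxx.
case: eqP => [e|_]; last by rewrite /= linvK eqxx.
case: r rr => [|c r] /=; first by rewrite e.
by rewrite -e => /andP[/negbTE -> _].
Qed.

Lemma reduced_foldr_push r s : reduced r -> reduced (foldr (@push n) r s).
Proof. by move=> rr; elim: s => //= a s; exact: reduced_push. Qed.

Lemma winv_cons a s : winv (a :: s) = rcons (winv s) (linv a).
Proof. by rewrite /winv /= rev_cons. Qed.

Lemma foldr_push_winvK r p : reduced r ->
  foldr (@push n) (foldr (@push n) r p) (winv p) = r.
Proof.
move=> rr; elim: p => [//|a p ih].
by rewrite winv_cons foldr_rcons /= pushK //; exact: reduced_foldr_push.
Qed.

Lemma red_id r : reduced r -> red r = r.
Proof.
elim: r => [//|a r ih] rr; have {}ih := ih (path_sorted rr).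
rewrite /red /= -/(red r) ih; case: r rr {ih} => [//|b r] /=.
by move=> /andP[/negbTE -> _].
Qed.

Lemma dX_cat p s t : dX (p ++ s) (p ++ t) = dX s t.
Proof.
rewrite /dX /winv map_cat rev_cat -/(winv p) -/(winv s) /red -!catA.
rewrite !foldr_cat foldr_push_winvK //.
by elim: t => //= a t ih; exact: reduced_push.
Qed.

(** For reduced words, this is the condition for [winv s ++ t] to have no cancellation. *)
Definition diverge s t : bool :=
  if (s, t) is (a :: _, b :: _) then a != b else true.

Lemma divergeC s t : diverge s t = diverge t s.
Proof. by case: s t => [|a s] [|b t] //; rewrite /diverge eq_sym. Qed.

Lemma dX_diverge s t : reduced s -> reduced t -> diverge s t ->
  dX s t = (size s + size t)%N.
Proof.
move=> rs rt; rewrite /dX /red foldr_cat -/(red t) red_id //.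
elim: s t rs rt => [//|a s ih] t rs rt st.
rewrite winv_cons foldr_rcons.
have -> : push (linv a) t = linv a :: t.
  by case: t st {rt} => [//|b t] /=; rewrite linvK eq_sym => /negbTE ->.
rewrite ih /= ?addSnnS //; first exact: path_sorted rs.
  case: t rt st => [//|b t]; rewrite /reduced /= => -> ab.
  by rewrite linvK eq_sym andbT; exact: ab.
by case: s rs {ih st} => [//|b s] /andP[].
Qed.

Lemma split_diverge u v : exists p s t,
  [/\ u = p ++ s, v = p ++ t & diverge s t].
Proof.
elim: u v => [|a u ih] v; first by exists [::], [::], v.
case: v => [|b v]; first by exists [::], (a :: u), [::].
case: (eqVneq a b) => [<-|ab]; last by exists [::], (a :: u), (b :: v).
by have [p [s [t [-> -> st]]]] := ih v; exists (a :: p), s, t.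
Qed.

Lemma dX_split p s t : reduced (p ++ s) -> reduced (p ++ t) -> diverge s t ->
  dX (p ++ s) (p ++ t) = (size s + size t)%N.
Proof.
by move=> /reduced_catr rs /reduced_catr rt st; rewrite dX_cat dX_diverge.
Qed.

Lemma dXC u v : reduced u -> reduced v -> dX u v = dX v u.
Proof.
have [p [s [t [-> -> st]]]] := split_diverge u v => rs rt.
by rewrite !dX_split // 1?addnC // divergeC.
Qed.

Lemma dX_id u : reduced u -> dX u u = 0%N.
Proof. by move=> ru; have := @dX_split u [::] [::]; rewrite cats0 => ->. Qed.

Lemma dX_take w i j : reduced w -> (i <= size w)%N -> (j <= size w)%N ->
  dX (take i w) (take j w) = (i - j + (j - i))%N.
Proof.
move=> rw; have rt k : reduced (take k w).
  by apply: (@reduced_catl _ (drop k w)); rewrite cat_take_drop.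
wlog ij : i j / (i <= j)%N => [th|iw jw].
  case: (leqP i j) => [/th//|/ltnW ji] iw jw.
  by rewrite dXC // th // addnC.
have e : take j w = take i w ++ drop i (take j w).
  by rewrite -{1}(take_takel w ij) cat_take_drop.
have := @dX_split (take i w) [::] (drop i (take j w)).
rewrite cats0 -e => -> //; rewrite size_drop size_takel //.
by move: ij => /eqP ->.
Qed.

Lemma adjX_rcons u a : reduced (rcons u a) -> adjX u (rcons u a).
Proof.
rewrite -cats1 /adjX -{2}(cats0 u) => ru.
by rewrite dX_split // cats0; exact: reduced_catl ru.
Qed.

Lemma adjXC u v : reduced u -> reduced v -> adjX u v = adjX v u.
Proof. by move=> ru rv; rewrite /adjX dXC. Qed.

Lemma adjXP u v : reduced u -> reduced v ->
  adjX u v <-> (exists a, v = rcons u a) \/ (exists a, u = rcons v a).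
Proof.
move=> ru rv; split; last first.
  move=> [[a e]|[a e]]; last rewrite adjXC //; rewrite e;
  by apply: adjX_rcons; rewrite -e.
move: ru rv; have [p [s [t [-> -> st]]]] := split_diverge u v => ru rv.
rewrite /adjX dX_split //.
case: s st ru => [|a [|c s]] st ru //=.
  case: t st rv => [//|b [|c t]] st rv //= _.
  by left; exists b; rewrite cats0 cats1.
by case: t st rv => // _ _ _; right; exists a; rewrite cats0 cats1.
Qed.

(** Removing the edge between [v] and [rcons v a] separates the words with prefix [rcons v a] from
    all others. The later arguments on rays and subtrees use the tree structure in this form. *)
Lemma adjX_cross v a x y : reduced x -> reduced y -> adjX x y ->
  prefix (rcons v a) x -> ~~ prefix (rcons v a) y -> x = rcons v a /\ y = v.
Proof.
move=> rx ry /(adjXP rx ry)[[b ->]|[b ->]] px.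
  by rewrite (prefix_trans px (prefix_rcons _ _)).
case/prefixP: px => s; case/lastP: s => [|s c].
  by rewrite cats0 => /rcons_inj[-> ->].
by rewrite -rcons_cat => /rcons_inj[-> _]; rewrite prefix_prefix.
Qed.

End Words.

(** * Ends of geodesic rays through an oriented edge *)

Section Cylinders.
Context {n : nat}.
Implicit Types (a b : letter n) (p s t u v w r : seq (letter n)) (xi : bdry n).

Definition ray (x : nat -> seq (letter n)) :=
  (forall k, reduced (x k)) /\
  (forall i j, dX (x i) (x j) = (i - j) + (j - i))%N.

Lemma ray_adj x k : ray x -> adjX (x k) (x k.+1).
Proof. by move=> [_ dx]; rewrite /adjX dx subSnn (eqP (leqnSn k)). Qed.

Lemma ray_noreturn x k : ray x -> x k.+1 <> x 0%N.
Proof. by move=> [rx dx] e; have := dx 0%N k.+1; rewrite e dX_id. Qed.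

Lemma pref_take xi j k : (j <= k)%N -> take j (pref xi k) = pref xi j.
Proof. by move=> jk; rewrite /pref /mkseq -map_take take_iota (minn_idPl jk). Qed.

Lemma pref_add xi m k :
  pref xi (m + k) = pref xi m ++ [seq sval xi i | i <- iota m k].
Proof. by rewrite /pref /mkseq iotaD map_cat. Qed.

Lemma prefix_pref w xi k : (size w <= k)%N ->
  prefix w (pref xi k) <-> cyl w xi.
Proof. by move=> wk; rewrite prefixE pref_take //; split=> /eqP. Qed.

Lemma dX_pref xi i j : dX (pref xi i) (pref xi j) = (i - j + (j - i))%N.
Proof.
have := @dX_take _ (pref xi (maxn i j)) i j (reduced_pref _ _).
by rewrite size_pref leq_maxl leq_maxr !pref_take ?leq_maxl ?leq_maxr//; apply.
Qed.

(** A ray that has entered the branch at [rcons v a] could leave it only through its starting vertex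
    [v], which a geodesic never revisits. Conversely, the prefixes of [xi] from length [size v] on
    form the required ray. *)
Lemma Cyl_down v a : reduced (rcons v a) ->
  Cyl v (rcons v a) = cyl (rcons v a).
Proof.
move=> rw; apply/seteqP; split=> xi.
  move=> [x [x0 x1 rx dx [c1 [c2 xc]]]]; have ryx : ray x by [].
  have px k : prefix (rcons v a) (x k.+1).
    elim: k => [|k ih]; first by rewrite x1 prefix_refl.
    apply: contraT => np; have [_ e] := adjX_cross (rx _) (rx _) (ray_adj k.+1 ryx) ih np.
    by case: (@ray_noreturn x k.+1 ryx); rewrite e x0.
  have := px (size (rcons v a) + c1)%N; rewrite -addSn xc => /prefix_pref.
  by apply; rewrite addSn -addnS leq_addr.
move=> wxi; exists (fun k => pref xi (k + size v)); split.
- rewrite add0n; have : pref xi (size v) = take (size v) (rcons v a).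
    by rewrite -[in RHS]wxi pref_take // size_rcons.
  by rewrite -cats1 take_size_cat.
- by rewrite add1n -(size_rcons v a).
- by move=> k; exact: reduced_pref.
- by move=> i j; rewrite dX_pref !subnDr.
- by exists 0%N, (size v) => k; rewrite addn0.
Qed.

(** A ray that has left the branch could re-enter it only through its starting vertex. Conversely,
    the ray towards [xi] climbs from [w] to the longest common prefix [p] of [w] and [xi], then
    follows [xi]. *)
Lemma Cyl_up v a : reduced (rcons v a) ->
  Cyl (rcons v a) v = ~` cyl (rcons v a).
Proof.
move=> rw; apply/seteqP; split=> xi.
  move=> [x [x0 x1 rx dx [c1 [c2 xc]]]]; have ryx : ray x by [].
  have px k : ~~ prefix (rcons v a) (x k.+1).
    elim: k => [|k ih].
      by rewrite x1; apply/negP => /size_prefix; rewrite size_rcons ltnn.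
    apply/negP => pk.
    have adj : adjX (x k.+2) (x k.+1) by rewrite adjXC //; exact: ray_adj.
    have [e _] := adjX_cross (rx _) (rx _) adj pk ih.
    by case: (@ray_noreturn x k.+1 ryx); rewrite e x0.
  have := px (size (rcons v a) + c1)%N; rewrite -addSn xc => /negP np wxi.
  by apply: np; apply/prefix_pref => //; rewrite addSn -addnS leq_addr.
set w := rcons v a => nw.
have [p [s [t [ws xt st]]]] := split_diverge w (pref xi (size w)).
set m := size p; set l := size s.
have wE : size w = (m + l)%N by rewrite ws size_cat.
have pm : pref xi m = p.
  by rewrite -(@pref_take xi m (size w)) ?wE ?leq_addr // -wE xt take_size_cat.
have tE : t = [seq sval xi i | i <- iota m l].
  have /eqP := xt; rewrite wE pref_add pm eqseq_cat // => /andP[_ /eqP //].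
have l0 : (0 < l)%N.
  rewrite lt0n size_eq0; apply/eqP => s0; apply: nw.
  by rewrite /cyl /= xt ws tE /l s0.
(* Divergence looks only at first letters, so it persists when [s] is truncated and the tail of [xi]
   is shortened or prolonged. *)
have st' i k : diverge (take i s) [seq sval xi i | i <- iota m k].
  move: st l0; rewrite tE /l; case: (s) => [//|c s'] cd _.
  by case: i k => [|i] [|k].
have tw i : (i <= l)%N -> take (size w - i) w = p ++ take (l - i) s.
  move=> il; rewrite wE -addnBA // ws take_cat ltnNge leq_addr /=.
  by rewrite addKn.
(* The first [l] steps erase [s] letter by letter; at time [l] the ray is at [p], the prefix of [xi]
   of length [m]. *)
pose x k := if (k <= l)%N then take (size w - k) w else pref xi (m + (k - l)).
have rx k : reduced (x k).
  rewrite /x; case: ifP => _; last exact: reduced_pref.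
  by apply: (@reduced_catl _ _ (drop (size w - k) w)); rewrite cat_take_drop.
exists x; split=> //.
- by rewrite /x subn0 take_size.
- by rewrite /x l0 /w size_rcons subn1 -cats1 take_size_cat.
- move=> i j; wlog ij : i j / (i <= j)%N => [th|].
    by case: (leqP i j) => [/th//|/ltnW ji]; rewrite dXC // th // addnC.
  rewrite /x; case: (leqP i l) => il; case: (leqP j l) => jl.
  + by rewrite dX_take ?leq_subr //; lia.
  + have rj := reduced_pref xi (m + (j - l)).
    have ri := rx i; rewrite /x il in ri.
    rewrite tw // in ri *; rewrite pref_add pm in rj *.
    rewrite dX_split // size_map size_iota size_takel /l ?leq_subr //.
    by rewrite -/l; lia.
  + by lia.
  + by rewrite dX_pref; lia.
(* Starting at time [l.+1] keeps the index strictly inside the second branch of [x]. *)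
- exists l.+1, m.+1 => k; rewrite /x ifN; last by rewrite -ltnNge; lia.
  by congr pref; lia.
Qed.

Lemma Cyl_cases v u : reduced v -> reduced u -> adjX v u ->
  (exists2 a, u = rcons v a & Cyl v u = cyl u) \/
  (exists2 a, v = rcons u a & Cyl v u = ~` cyl v).
Proof.
move=> rv ru /(adjXP rv ru)[[a e]|[a e]]; [left|right]; exists a => //.
  by rewrite e Cyl_down // -e.
by rewrite e Cyl_up // -e.
Qed.

Lemma open_Cyl v u : reduced v -> reduced u -> adjX v u -> open (Cyl v u).
Proof.
move=> rv ru /(Cyl_cases rv ru)[[a _ ->]|[a _ ->]]; first exact: open_cyl.
by rewrite openC; exact: closed_cyl.
Qed.

Lemma measurable_SCyl T : SubX T -> measurable (SCyl T : set (CNm n)).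
Proof.
move=> [rT _ _].
have oC v u : termE T v u -> open (Cyl v u).
  by move=> [vT uT vu _]; apply: open_Cyl => //; exact: rT.
pose E := [set e | termE T e.1 e.2].
have -> : SCyl T = inCN (\bigcup_(e in E) Cyl e.1 e.2) `&`
    \bigcap_(e in E) meetCN (Cyl e.1 e.2).
  apply/seteqP; split=> S [h1 h2]; split.
  - by move=> xi /h1[v [u [vu Cxi]]]; exists (v, u).
  - by move=> [v u] /h2[xi [Sxi Cxi]]; exists xi.
  - by move=> xi /h1[[v u] vu Cxi]; exists v, u.
  - by move=> v u vu; have [xi [Sxi Cxi]] := h2 (v, u) vu; exists xi.
apply: measurableI.
  apply: measurable_openCN; apply: open_inCN; apply: bigcup_open => e Ee.
  exact: oC.
apply: fin_bigcap_measurable.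
  apply: (@sub_finite_set _ _ ([set` T] `*` [set` T])).
    by move=> [v u] [].
  by apply: finite_setX; exact: finite_fset.
by move=> e Ee; apply: measurable_openCN; apply: open_meetCN; exact: oC.
Qed.

End Cylinders.

(** * Finite subtrees containing the vertex 1, and stars *)

Section Trees.
Context {n : nat}.
Implicit Types (a b : letter n) (u v w : seq (letter n)) (T : {fset seq (letter n)}).
Implicit Types A : {set letter n}.

(** A path in [T] from [rcons v a] to 1 must leave the branch at [rcons v a], and its first vertex
    outside is [v]. *)
Lemma parent_in_tree T v a : SubX1 T -> rcons v a \in T -> v \in T.
Proof.
move=> [[rT _ cT] T1] uT.
have [p [pp pl pT]] := cT _ _ uT T1.
suff main x : x \in T -> path (@adjX n) x p -> last x p = [::] ->
    prefix (rcons v a) x -> v \in T by exact: (main _ uT pp pl (prefix_refl _)).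
elim: p x pT {pp pl} => [|y p ih] x /=; first by move=> _ _ _ ->; case: (v).
move=> /andP[yT pT] xT /andP[xy pp] pl px.
case: (boolP (prefix (rcons v a) y)) => [py|npy]; first exact: (ih y).
by have [_ <-] := adjX_cross (rT _ xT) (rT _ yT) xy px npy.
Qed.

Lemma deg1 T u v : v \in T -> adjX u v ->
  (forall w, w \in T -> adjX u w -> w = v) -> deg T u = 1%N.
Proof.
move=> vT uv h; rewrite /deg; apply/eqP/cardfs1P; exists v.
apply/fsetP => w; rewrite !inE; apply/andP/eqP => [[wT uw]|->//].
exact: h.
Qed.

(** Extending [u] inside [T] must stop, since word lengths in [T] are bounded by [K]; the induction
    is on [K - size u]. A vertex other than 1 without a child in [T] has its parent as only
    neighbour there. *)
Lemma exists_leaf T u : SubX1 T -> u \in T -> u != [::] ->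
  exists v a, prefix u (rcons v a) /\ termE T v (rcons v a).
Proof.
move=> sT; have [[rT _ _] T1] := sT; have [K KP] := fset_nat_bound size T.
have leaf w : w \in T -> w != [::] -> ~ (exists a, rcons w a \in T) ->
    exists v a, prefix w (rcons v a) /\ termE T v (rcons v a).
  case/lastP: w => [//|v a] vaT _ nch; exists v, a.
  have vT : v \in T by exact: parent_in_tree vaT.
  have av : adjX v (rcons v a) by apply: adjX_rcons; exact: rT.
  split; first exact: prefix_refl.
  split=> //; apply: (@deg1 _ _ v) => //.
    by rewrite adjXC //; exact: rT.
  move=> w wT /(adjXP (rT _ vaT) (rT _ wT))[[b e]|[b]].
    by case: nch; exists b; rewrite -e.
  by move=> /rcons_inj[].
move: {2}(K - size u)%N (leqnn (K - size u)%N) => m.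
elim: m u => [|m ih] u um uT u0.
all: case: (pselect (exists a, rcons u a \in T)) => [[a uaT]|]; last exact: leaf.
- move: um; rewrite leqn0 subn_eq0 => /(leq_trans (KP _ uaT)).
  by rewrite size_rcons ltnn.
- have [|||v [b [pv vb]]] := ih (rcons u a) => //.
  + by rewrite size_rcons subnS; move: um; case: (K - size u)%N.
  + by case: (u).
  + by exists v, b; split=> //; exact: prefix_trans (prefix_rcons _ _) pv.
Qed.

Lemma cyl_prefix u w (xi : bdry n) : prefix u w -> cyl w xi -> cyl u xi.
Proof.
move=> pu wxi; apply/(@prefix_pref _ u xi (size w)); first exact: size_prefix.
by rewrite wxi.
Qed.

Lemma SCyl_sub_E1 T : SubX1 T -> SCyl T `<=` E1.
Proof.
move=> sT S [_ ST]; have [[rT cT _] T1] := sT.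
have [_ [x [_ [Sx _]]]] := svalP S; set a := sval x 0%N.
suff [y [Sy ya]] : exists y, sval S y /\ ~ cyl [:: a] y.
  exists x, y; split=> //; apply/eqP => xy; apply: ya.
  exact/esym/pref1_eqP.
(* If [T] has a vertex in a branch other than that of [a], a leaf beyond it supplies an end of [S]
   with another first letter. *)
case: (pselect (exists b u, b != a /\ b :: u \in T)) => [[b [u [ba uT]]]|h].
  have [v [c [pv vc]]] := exists_leaf sT uT isT.
  have [y [Sy Cy]] := ST _ _ vc; exists y; split=> // -[ya].
  have [_ vcT _ _] := vc; rewrite Cyl_down in Cy; last exact: rT.
  have : cyl [:: b] y.
    by apply: cyl_prefix Cy; apply: prefix_trans pv; rewrite prefix_cons prefix0s eqxx.
  by move=> [yb]; move: ba; rewrite -yb ya eqxx.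
(* Any vertex of [T] other than 1 has a prefix of length one in [T], which by [h] can only be
   [[:: a]]. *)
have aT : [:: a] \in T.
  have [u] : exists u, u \in (T `\ [::])%fset.
    by apply/fset0Pn; rewrite -cardfs_gt0; move: cT; rewrite (cardfsD1 [::]) T1.
  rewrite !inE => /andP[u0 uT].
  elim/last_ind: u u0 uT => [//|u b ih] _ uT.
  case: (eqVneq u [::]) => [u0|u0]; last first.
    by apply: ih => //; exact: parent_in_tree uT.
  case: (eqVneq b a) => [<-|ba]; first by move: uT; rewrite u0.
  by case: h; exists b, [::]; split=> //; move: uT; rewrite u0.
have ra : reduced [:: a] by [].
have adj : adjX [::] [:: a] by exact: (@adjX_rcons _ [::] a).
(* All of [T] now lies in the branch of [a], so 1 is itself a leaf, and the ends through its
   terminal edge are those not beginning with [a]. *)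
have ta : termE T [:: a] [::].
  split=> //; apply: (@deg1 _ _ [:: a]) => // w wT.
  move=> /(@adjXP _ [::] w isT (rT _ wT))[[b /= wb]|[b]]; last by case: (w).
  case: (eqVneq b a) => [<-//|ba]; case: h.
  by exists b, [::]; split=> //; rewrite -wb.
have [y [Sy]] := ST _ _ ta; rewrite (@Cyl_up _ [::] a) // => ya.
by exists y.
Qed.

Definition star (A : {set letter n}) : {fset seq (letter n)} :=
  ([::] |` [fset [:: a] | a in A])%fset.

Lemma in_star A u : u \in star A <-> u = [::] \/ exists2 a, a \in A & u = [:: a].
Proof.
rewrite !inE; split.
  move=> /orP[/eqP ->|/imfsetP[a /= aA ->]]; first by left.
  by right; exists a.
move=> [->|[a aA ->]]; first by rewrite eqxx.
by apply/orP; right; apply/imfsetP; exists a.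
Qed.

Lemma adjX1 a : adjX [::] [:: a].
Proof. exact: (@adjX_rcons _ [::] a). Qed.

Lemma reduced_star A u : u \in star A -> reduced u.
Proof. by move=> /in_star[->|[a _ ->]]. Qed.

Lemma star1 A : [::] \in star A.
Proof. by apply/in_star; left. Qed.

Lemma star_letter A a : a \in A -> [:: a] \in star A.
Proof. by move=> aA; apply/in_star; right; exists a. Qed.

Lemma deg_star1 A a b : a \in A -> b \in A -> a != b -> (2 <= deg (star A) [::])%N.
Proof.
move=> /star_letter + /star_letter; move: (star A) => T aT bT ab.
have := cardfs2 [:: a] [:: b].
rewrite eqseq_cons andbT ab => e; rewrite -[2]e; apply: fsubset_leq_card.
by apply/fsubsetP => u; rewrite !inE => /orP[] /eqP ->; rewrite adjX1 ?aT ?bT.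
Qed.

Lemma deg_star_letter A a : a \in A -> deg (star A) [:: a] = 1%N.
Proof.
move=> aA; apply: (@deg1 _ _ [::]).
- exact: star1.
- by rewrite adjXC // adjX1.
- move=> w /[dup] wA /in_star[->//|[b bA wb]].
  move=> /(@adjXP _ [:: a] w isT (reduced_star wA))[[c]|[c]]; first by rewrite wb.
  by rewrite wb.
Qed.

Lemma star_R1 A a b : a \in A -> b \in A -> a != b -> R1 (star A).
Proof.
move=> aA bA ab; split.
- split; first exact: reduced_star.
    rewrite -(cardfs2 [::] [:: a]) /=; apply: fsubset_leq_card.
    apply/fsubsetP => u; rewrite in_fset2 => /orP[] /eqP ->; first exact: star1.
    exact: star_letter.
  move=> u v uA vA; have rv := reduced_star vA; have ru := reduced_star uA.
  have [p [pp pl pT]] : exists p, [/\ path (@adjX n) [::] p, last [::] p = v &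
      all (fun w => w \in star A) p].
    case/in_star: (vA) => [->|[c cA ->]]; first by exists [::].
    by exists [:: [:: c]]; split=> //; rewrite all_seq1 star_letter.
  case/in_star: uA => [->|[c cA ->]]; first by exists p.
  exists ([::] :: p); split; [|exact: pl|by apply/andP; rewrite star1].
  by rewrite -[path _ _ _]/(adjX _ _ && path _ _ _) adjXC // adjX1.
- exact: star1.
- exact: deg_star1 ab.
- move=> u /in_star[->|[c cA ->]]; last by move=> _; apply/eqP; exact: adjX1.
  by move=> e; have := deg_star1 aA bA ab; rewrite e.
Qed.

Lemma termE_star A a b : a \in A -> b \in A -> a != b ->
  forall v u, termE (star A) v u <-> v = [::] /\ exists2 c, c \in A & u = [:: c].
Proof.
move=> aA bA ab v u; split.
  move=> [vA uA vu du]; case/in_star: (uA) => [u0|[c cA uc]].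
    by have := deg_star1 aA bA ab; rewrite -u0 du.
  split; last by exists c.
  case/in_star: (vA) => [//|[d dA vd]]; move: vu.
  by move=> /(adjXP (reduced_star vA) (reduced_star uA)); rewrite uc vd => -[] [].
move=> [-> [c cA ->]]; split; [exact: star1|exact: star_letter|exact: adjX1|].
exact: deg_star_letter.
Qed.

(** The star is spanned by the first letters of the ends of [S]. *)
Lemma E1_sub_star (S : CN n) : E1 S -> exists2 A, R1 (star A) & SCyl (star A) S.
Proof.
move=> [x [y [Sx Sy xy]]].
pose A : {set letter n} := [set a : letter n | `[< sval S `&` cyl [:: a] !=set0 >]]%SET.
have AP z : sval S z -> sval z 0%N \in A.
  by move=> Sz; rewrite inE; apply/asboolP; exists z.
have tE := termE_star (AP _ Sx) (AP _ Sy) xy.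
exists A; first exact: star_R1 (AP _ Sx) (AP _ Sy) xy.
have CE c : Cyl [::] [:: c] = cyl [:: c] by exact: (@Cyl_down _ [::] c).
split=> [z Sz|v u /tE[-> [c cA ->]]].
  exists [::], [:: sval z 0%N]; split; last by rewrite CE.
  by apply/tE; split=> //; exists (sval z 0%N) => //; exact: AP.
by move: cA; rewrite inE => /asboolP[z [Sz zc]]; exists z; rewrite CE.
Qed.

End Trees.

(** * Currents *)

Local Open Scope ring_scope.
Local Open Scope ereal_scope.

(** Equality of the underlying functions lets results on product measures, stated for bundled
    sigma-finite measures, be carried back to [nu]. *)
Lemma sigma_finite_measure_of d (T : measurableType d) (R : realType)
    (nu : {measure set T -> \bar R}) : sigma_finite setT nu ->
  exists nu' : {sigma_finite_measure set T -> \bar R},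
    (nu' : set T -> \bar R) = nu.
Proof.
move=> sf; have sfin := sfinite_measure_sigma_finite sf.
pose H1 := isSFinite.Build d T R (Measure.sort nu) sfin.
pose H2 := isSigmaFinite.Build d T R (Measure.sort nu) sf.
by exists (HB.pack_for (SigmaFiniteMeasure.type T R) (Measure.sort nu) H1 H2).
Qed.

Section PushIntersection.
Context {n : nat} {R : realType}.
Context (m : {measure set (CNm n * CNm n) -> \bar R}).

(** The image measure under intersection, written with [Ipre] because the map is only partial. *)
Definition Ipush (U : set (CNm n)) : \bar R := m (Ipre U).

Let Ipush0 : Ipush set0 = 0.
Proof. by rewrite /Ipush Ipre0 measure0. Qed.

Let Ipush_ge0 U : 0 <= Ipush U.
Proof. exact: measure_ge0. Qed.

Let Ipush_sigma_additive : semi_sigma_additive Ipush.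
Proof.
move=> F mF tF mUF; rewrite /Ipush Ipre_bigcup.
apply: measure_semi_sigma_additive.
- by move=> i; exact: measurable_Ipre.
- exact: Ipre_trivIset.
- by apply: bigcupT_measurable => i; exact: measurable_Ipre.
Qed.

HB.instance Definition _ := isMeasure.Build _ _ _ Ipush
  Ipush0 Ipush_ge0 Ipush_sigma_additive.

End PushIntersection.

Section Currents.
Context {n : nat} {R : realType}.
Implicit Types mu nu : {measure set CNm n -> \bar R}.

Lemma measurable_E1 : measurable (E1 : set (CNm n)).
Proof. by apply: measurable_openCN; exact: open_E1. Qed.

Lemma current_actCN mu g (U : set (CNm n)) : subset_current mu -> reduced g ->
  measurable U -> mu (actCN g @^-1` U) = mu U.
Proof. by move=> [inv _] rg mU; rewrite -translE // inv. Qed.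

Lemma measurable_preimage_actCN g (U : set (CNm n)) :
  measurable U -> measurable (actCN g @^-1` U : set (CNm n)).
Proof.
by move=> mU; rewrite -[X in measurable X]setTI; exact: measurable_actCN.
Qed.

Lemma current_sigma_finite mu : subset_current mu -> sigma_finite setT mu.
Proof.
move=> cmu; pose F (i : nat) : set (CNm n) :=
  if choice.unpickle i is Some g then if reduced g then actCN g @^-1` E1 else set0
  else set0.
exists F.
  apply/seteqP; split=> // S _; have [g rg gS] := exists_act_E1 S.
  by exists (choice.pickle g) => //; rewrite /F choice.pickleK rg.
move=> i; rewrite /F; case: choice.unpickle => [g|]; last by rewrite measure0.
case: ifPn => rg; last by rewrite measure0.
split; first by apply: measurable_preimage_actCN; exact: measurable_E1.
rewrite current_actCN //; last exact: measurable_E1.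
by case: cmu => _; apply; exact: compact_E1.
Qed.

Lemma current_sigma_finite_measure mu : subset_current mu ->
  exists mu' : {sigma_finite_measure set CNm n -> \bar R},
    (mu' : set (CNm n) -> \bar R) = mu.
Proof. by move=> /current_sigma_finite/sigma_finite_measure_of. Qed.

Lemma measurable_current_xsection nu (A : set (CNm n * CNm n)) :
  subset_current nu -> measurable A ->
  measurable_fun [set: CNm n] (nu \o xsection A).
Proof.
move=> /current_sigma_finite_measure[nu' <-] mA.
exact: measurable_fun_xsection.
Qed.

(** Invariance is applied one factor at a time: that of [nu] inside each section, then that of [mu]
    as a change of variables in the outer integral. *)
Lemma prod_current_actCN mu nu g (U : set (CNm n)) :
  subset_current mu -> subset_current nu -> reduced g -> measurable U ->
  (mu \x nu) (Ipre (actCN g @^-1` U)) = (mu \x nu) (Ipre U).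
Proof.
move=> cmu cnu rg mU; have mI := measurable_Ipre mU.
pose f : CNm n -> \bar R := nu \o xsection (Ipre U).
have mf : measurable_fun setT f by exact: measurable_current_xsection.
rewrite /product_measure1.
transitivity (\int[mu]_x (f \o actCN g) x).
  apply: eq_integral => x _; rewrite /f /=.
  rewrite -[RHS](current_actCN cnu rg) //; last exact: measurable_xsection.
  congr (nu _); apply/seteqP; split=> y /=.
    by rewrite /xsection /= !inE => /Ipre_actCN.
  by rewrite /xsection /= !inE => h; apply/Ipre_actCN.
have := @ge0_integral_pushforward _ _ _ _ _ _ (measurable_actCN g) mu setT f
  measurableT mf (fun _ _ => measure_ge0 _ _).
rewrite preimage_setT => <-; apply: eq_measure_integral.
  exact: measurable_actCN.
by move=> mg A mA _; exact: (current_actCN cmu rg mA).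
Qed.

Lemma prod_current_E1 mu nu : subset_current nu ->
  (mu \x nu) (Ipre E1) <= mu E1 * nu E1.
Proof.
move=> /current_sigma_finite_measure[nu' <-].
rewrite -product_measure1E; [|exact: measurable_E1|exact: measurable_E1].
apply: le_measure; rewrite ?inE.
- by apply: measurable_Ipre; exact: measurable_E1.
- by apply: measurableX; exact: measurable_E1.
- move=> p [S [[x [y [+ + xy]]] Sp]]; rewrite Sp => -[x1 x2] [y1 y2].
  by split; exists x, y.
Qed.

Lemma current_E1_Vol mu : mu E1 <= Vol mu.
Proof.
(* There are finitely many stars, as the alphabet is finite, and their cylinders cover [E1]; finite
   subadditivity bounds [mu E1] by a finite partial sum of [Vol mu]. *)
pose X := [set T | R1 T /\ exists A : {set letter n}, T = star A].
have finX : finite_set X.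
  apply: (@sub_finite_set _ _ (@star n @` setT)).
    by move=> _ [_ [A ->]]; exists A.
  by apply: finite_image; exact: finite_finset.
apply: esum_ge; exists X; first by split=> // T [].
apply: content_sub_fsum => //.
- by move=> T [[sT _ _ _] _]; exact: measurable_SCyl.
- exact: measurable_E1.
- by move=> S /E1_sub_star[A RA SA]; exists (star A) => //; split=> //; exists A.
Qed.

Lemma prod_current_measure mu nu : subset_current nu ->
  exists m : {measure set (CNm n * CNm n) -> \bar R}, forall A, m A = (mu \x nu) A.
Proof.
by move=> /current_sigma_finite_measure[nu' <-]; exists (mu \x nu').
Qed.

Lemma prod_current_compact mu nu (K : set (CN n)) :
  subset_current mu -> subset_current nu -> compact K ->
  (mu \x nu) (Ipre K) < +oo.
Proof.
move=> cmu cnu cK; have [m mE] := prod_current_measure mu cnu.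
have mK : measurable (K : set (CNm n)).
  rewrite -[K]setCK; apply: measurableC; apply: measurable_openCN.
  by rewrite openC; apply: compact_closed => //; exact: hausdorff_CN.
have oact g : open (actCN g @^-1` E1 : set (CN n)).
  by have /continuousP := @continuous_actCN n g; apply; exact: open_E1.
move: cK; rewrite compact_cover.
move=> /(_ _ [set g : seq (letter n) | reduced g] (fun g => actCN g @^-1` E1)).
case=> [g _||D Dr KD]; first exact: oact.
  by move=> S _; have [g rg gS] := exists_act_E1 S; exists g.
rewrite -mE -[m _]/(Ipush m K).
(* By invariance each translate in the finite subcover has the mass of [Ipre E1], which is finite
   because [E1] is compact. *)
apply: (@le_lt_trans _ _ (\sum_(g \in [set` D]) Ipush m (actCN g @^-1` E1))).
  apply: content_sub_fsum => //.
  by move=> g _; apply: measurable_preimage_actCN; exact: measurable_E1.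
rewrite fsbig_finite //= set_fsetK big_seq; apply: lte_sum_pinfty => g gD.
have /set_mem rg : g \in [set g : seq (letter n) | reduced g].
  exact: Dr.
rewrite /Ipush mE prod_current_actCN //; last exact: measurable_E1.
apply: (le_lt_trans (prod_current_E1 mu cnu)).
case: cmu cnu => [_ fmu] [_ fnu]; apply: lte_mul_pinfty => //.
  by rewrite ge0_fin_numE //; apply: fmu; exact: compact_E1.
by apply: fnu; exact: compact_E1.
Qed.

Lemma prod_current_linl mu mu' nu (a b : {nonneg R}) (A : set (CNm n * CNm n)) :
  subset_current nu -> measurable A ->
  ((measure_add (mscale a mu) (mscale b mu')) \x nu) A =
  a%:num%:E * (mu \x nu) A + b%:num%:E * (mu' \x nu) A.
Proof.
move=> cnu mA; have mf := measurable_current_xsection cnu mA.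
rewrite /product_measure1 ge0_integral_measure_add //.
by rewrite !ge0_integral_mscale.
Qed.

(** Here the sum sits inside the integral over [nu], so additivity of the integral requires the
    section masses for both [mu] and [mu'] to be measurable; sigma-finiteness of currents provides
    this. *)
Lemma prod_current_linr mu mu' nu (a b : {nonneg R}) (A : set (CNm n * CNm n)) :
  subset_current mu -> subset_current mu' -> measurable A ->
  (nu \x (measure_add (mscale a mu) (mscale b mu'))) A =
  a%:num%:E * (nu \x mu) A + b%:num%:E * (nu \x mu') A.
Proof.
move=> cmu cmu' mA.
have mf := measurable_current_xsection cmu mA.
have mf' := measurable_current_xsection cmu' mA.
rewrite /product_measure1 -!ge0_integralZl_EFin // -ge0_integralD //.
- by apply: eq_integral => x _ /=; rewrite measure_addE.
- by move=> x _; exact: mule_ge0.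
- exact: measurable_funeM.
- by move=> x _; exact: mule_ge0.
- exact: measurable_funeM.
Qed.

End Currents.

(* N = n.+2 (so that N >= 2); the subset currents take values in \bar R *)
Theorem mainTheorem6 (n : nat) (R : realType) :
  (forall mu nu : {measure set CNm n -> \bar R},
     subset_current mu -> subset_current nu ->
     [/\ (* well defined: I^{-1}(U) is measurable for the product sigma-algebra *)
         (forall U : set (CNm n), measurable U -> measurable (Ipre U)),
         (* it is (the restriction to Borel sets of) a subset current *)
         (exists lam : {measure set CNm n -> \bar R},
            subset_current lam /\
            forall U : set (CNm n), measurable U ->
              lam U = (mu \x nu) (Ipre U)) &
         (* the bound on subset cylinders *)
         (forall T : {fset (seq (letter n))}, SubX1 T ->
            (mu \x nu) (Ipre (SCyl T)) <= Vol mu * Vol nu)]) /\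
  (* R_{>=0}-bilinearity of Ihat *)
  (forall (mu mu' nu : {measure set CNm n -> \bar R}) (a b : {nonneg R}),
     subset_current mu -> subset_current mu' -> subset_current nu ->
     forall U : set (CNm n), measurable U ->
       ((measure_add (mscale a mu) (mscale b mu')) \x nu) (Ipre U)
         = a%:num%:E * (mu \x nu) (Ipre U) + b%:num%:E * (mu' \x nu) (Ipre U)
       /\
       (nu \x (measure_add (mscale a mu) (mscale b mu'))) (Ipre U)
         = a%:num%:E * (nu \x mu) (Ipre U) + b%:num%:E * (nu \x mu') (Ipre U)).
Proof.
split=> [mu nu cmu cnu|mu mu' nu a b cmu cmu' cnu U mU]; last first.
  have mI := measurable_Ipre mU; split; first exact: prod_current_linl.
  exact: prod_current_linr.
have [m mE] := prod_current_measure mu cnu.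
split.
- by move=> U; exact: measurable_Ipre.
- exists (Ipush m); split; last by move=> U _; exact: mE.
  split=> [g rg U mU|K cK]; rewrite /= /Ipush !mE.
    by rewrite translE // prod_current_actCN.
  exact: prod_current_compact.
- move=> T sT; apply: (@le_trans _ _ ((mu \x nu) (Ipre E1))).
    rewrite -!mE; apply: le_measure; rewrite ?inE.
    + by apply: measurable_Ipre; apply: measurable_SCyl; case: sT.
    + by apply: measurable_Ipre; exact: measurable_E1.
    + by apply: IpreS; exact: SCyl_sub_E1.
  apply: (le_trans (prod_current_E1 mu cnu)).
  by apply: lee_pmul => //; exact: current_E1_Vol.
Qed.
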